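(* Let $m,a,b,c>0$ be real numbers and let $k\ge 1$ be an integer with $b>k/c$. If $\beta=1$, then the factorial moment of order $k$ of $\mathcal{GNB\text{-}BE}(m,\beta,a,b,c)$ reduces to the factorial moment of order $k$ of the negative binomial-beta exponential distribution, which is $$\mu_{[k]}=\frac{\Gamma(m+k)}{\Gamma(m)}\sum_{j=0}^{k}\binom{k}{j}(-1)^{j}\,\frac{B\!\left(b-\frac{k-j}{c},\,a\right)}{B(a,b)}.$$
   Context: For $r,s>0$, $B(r,s)=\frac{\Gamma(r)\Gamma(s)}{\Gamma(r+s)}$. For real $y$ and integer $x\ge 0$, $\binom{y}{x}=\frac{y(y-1)\cdots(y-x+1)}{x!}$. The generalized negative binomial distribution $\mathcal{GNB}(m,\beta,\theta)$ has probability mass function $\frac{m}{m+\beta x}\binom{m+\beta x}{x}(1-\theta)^{x}\theta^{m+\beta x-x}$, $x=0,1,2,\dots$. The beta exponential distribution $\mathcal{BE}(a,b,c)$, $a,b,c>0$, has density $g(\lambda;a,b,c)=\frac{c}{B(a,b)}e^{-bc\lambda}(1-e^{-c\lambda})^{a-1}$ for $\lambda>0$. The distribution $\mathcal{GNB\text{-}BE}(m,\beta,a,b,c)$ is the mixture defined by $X\mid\lambda\sim\mathcal{GNB}(m,\beta,\theta=e^{-\lambda})$, $\lambda\sim\mathcal{BE}(a,b,c)$: its mass function is $$p(x)=\int_0^\infty \frac{m}{m+\beta x}\binom{m+\beta x}{x}(1-e^{-\lambda})^{x}e^{-\lambda(m+\beta x-x)}\,g(\lambda;a,b,c)\,d\lambda,\qquad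 x=0,1,2,\dots$$ The negative binomial-beta exponential distribution with parameters $(m,a,b,c)$ is the case $\beta=1$; its mass function is $h_1(x)=\binom{m+x-1}{x}\sum_{j=0}^{x}\binom{x}{j}(-1)^j\frac{B(b+\frac{m+j}{c},a)}{B(a,b)}$. The factorial moment of order $k$ is $\mu_{[k]}=E[X(X-1)\cdots(X-k+1)]$. *)

(* Defs.v *)
From HB Require Import structures.
From mathcomp Require Import all_boot all_order all_algebra.
From mathcomp Require Import all_classical all_reals all_analysis.
Set Implicit Arguments.
Unset Strict Implicit.
Unset Printing Implicit Defensive.
Import Order.TTheory GRing.Theory Num.Theory.
Import numFieldNormedType.Exports.
Local Open Scope classical_set_scope.
Local Open Scope ring_scope.

Section special_functions.
Context {R : realType}.

(* Meaningful for 0 < r only. *)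
Definition Gamma (r : R) : R :=
  \int[lebesgue_measure]_(t in `]0, +oo[) (t `^ (r - 1) * expR (- t)).

(* The library's beta_fun only takes natural number arguments. *)
Definition Beta (r s : R) : R := Gamma r * Gamma s / Gamma (r + s).

Definition falling (y : R) (n : nat) : R := \prod_(i < n) (y - i%:R).

Definition rbinom (y : R) (x : nat) : R := falling y x / x`!%:R.

End special_functions.

Section discrete_prob.
Context {R : realType}.
Local Open Scope ereal_scope.

Definition is_pmf (p : nat -> \bar R) : Prop :=
  (forall x, 0 <= p x) /\ \sum_(0 <= x <oo) p x = 1.

(* The distribution on nat with mass function p; as for the distributions of
   the library (poisson_prob, for instance), a Dirac measure stands in when p is
   not a mass function. *)
Definition discrete_prob (p : nat -> \bar R) : set nat -> \bar R :=
  fun U => if `[< is_pmf p >] then \esum_(x in U) p x else \d_0%N U.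

Section instances.
Variable p : nat -> \bar R.

Let discrete_prob0 : discrete_prob p set0 = 0.
Proof. by rewrite /discrete_prob measure0; case: ifPn => //; rewrite esum_set0. Qed.

Let discrete_prob_ge0 U : 0 <= discrete_prob p U.
Proof.
rewrite /discrete_prob; case: ifPn => // /asboolP[p0 _].
by apply: esum_ge0 => x _; exact: p0.
Qed.

Let discrete_prob_sigma_additive : semi_sigma_additive (discrete_prob p).
Proof.
move=> F mF tF mUF; rewrite /discrete_prob.
case: ifPn => [/asboolP[p0 _]|_]; last exact: measure_semi_sigma_additive.
apply: cvg_toP.
  apply: ereal_nondecreasing_is_cvgn => a b ab.
  by apply: lee_sum_nneg_natr => // n _ _; apply: esum_ge0 => x _; exact: p0.
by rewrite nneseries_sum_bigcup.
Qed.

HB.instance Definition _ := isMeasure.Build _ _ _ (discrete_prob p)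
  discrete_prob0 discrete_prob_ge0 discrete_prob_sigma_additive.

Let discrete_prob_setT : discrete_prob p [set: nat] = 1.
Proof.
rewrite /discrete_prob; case: ifPn => [/asboolP[p0 p1]|_].
  by rewrite -nneseries_esumT.
by rewrite probability_setT.
Qed.

HB.instance Definition _ :=
  @Measure_isProbability.Build _ _ R (discrete_prob p) discrete_prob_setT.

End instances.

(* E[X(X-1)...(X-k+1)] for X distributed according to P. *)
Definition factorial_moment (P : probability nat R) (k : nat) : \bar R :=
  'E_P[fun x : nat => falling x%:R k].

End discrete_prob.

Section distributions.
Context {R : realType}.
Implicit Types (m beta theta a b c lambda : R) (x : nat).

Definition gnb_pmf m beta theta x : R :=
  m / (m + beta * x%:R) * rbinom (m + beta * x%:R) x
  * (1 - theta) ^+ x * theta `^ (m + beta * x%:R - x%:R).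

Definition be_pdf a b c lambda : R :=
  c / Beta a b * expR (- (b * c * lambda))
  * (1 - expR (- (c * lambda))) `^ (a - 1).

Definition gnbbe_pmf m beta a b c x : \bar R :=
  (\int[lebesgue_measure]_(lambda in `]0%R, +oo[)
     (gnb_pmf m beta (expR (- lambda)) x * be_pdf a b c lambda)%:E)%E.

Definition gnbbe_prob m beta a b c : probability nat R :=
  discrete_prob (gnbbe_pmf m beta a b c).

(* gnbbe_pmf m 1 a b c x in closed form: expand (1 - expR (- lambda)) ^+ x and
   integrate each power of expR (- lambda) against be_pdf a b c. *)
Definition nbbe_pmf m a b c x : R :=
  rbinom (m + x%:R - 1) x *
  \sum_(0 <= j < x.+1)
    'C(x, j)%:R * (-1) ^+ j * (Beta (b + (m + j%:R) / c) a / Beta a b).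

Definition nbbe_prob m a b c : probability nat R :=
  discrete_prob (fun x => (nbbe_pmf m a b c x)%:E).

End distributions.

(* Main.v *)
Require Import Defs.
From mathcomp Require Import all_boot all_order all_algebra.
From mathcomp Require Import all_classical all_reals all_analysis.
From mathcomp Require Import measurable_realfun ring lra.
Import Order.TTheory GRing.Theory Num.Theory.
Import numFieldNormedType.Exports.
Local Open Scope classical_set_scope.
Local Open Scope ring_scope.

(** For beta = 1 the conditional law of X given l is the negative binomial law with
    success probability theta = e^(-l). Expanding (1 - e^(-l))^x by the binomial
    theorem and integrating each exponential against the beta exponential density
    turns the mass function of the mixture into the one of the negative
    binomial-beta exponential distribution (gnbbe_pmf_beta1). The two distributions
    are then equal, and so are their factorial moments.

    The moment itself is computed by conditioning on l. Shifting the summation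
    index in the negative binomial series shows that the conditional factorial
    moment is m (m + 1) ... (m + k - 1) ((1 - theta) / theta)^k
    (nb_factorial_moment). With theta = e^(-l) this is a multiple of
    (1 - e^(-l))^k e^(k l), which is again expanded by the binomial theorem and
    integrated term by term (gnbbe_falling_sum); the integrals converge because
    k / c < b. The product m (m + 1) ... (m + k - 1) is Gamma(m + k) / Gamma(m).
    For k = 0 the same computation says that the masses add up to 1.

    Two analytic facts carry this. The Laplace transform of the beta exponential
    density is a ratio of Beta functions (be_laplace): this is the identity
    Gamma(r) Gamma(s) = Gamma(r + s) B(r, s), with the Beta integral written in the
    variable e^(-c l) (egammaM). It is proved by Tonelli's theorem and two changes
    of variables on the half-line, as an identity between extended reals; its case
    s = 1 is the functional equation of Gamma, from which finiteness and positivity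
    of Gamma follow. The negative binomial series sums to (1 - q)^(-m) for every
    real m > 0 (negative_binomial_series): this is obtained by integrating the
    exponential series against the Gamma density. *)

Set Implicit Arguments.
Unset Strict Implicit.
Unset Printing Implicit Defensive.

Local Notation mu := lebesgue_measure.

(** * Integrals over the half-line *)

(** The substitution formula on a compact interval is applied to the intervals
    [1/(n+1), n+1] and the two sides pass to the limit by monotone convergence.
    The hypotheses on G bear on the open half-line only and f is not assumed to
    have a limit at infinity, because the integrands below may blow up at 0 and
    one of the substitutions has an exponentially growing derivative. *)
Lemma integration_by_substitution0y (R : realType) (F f G : R -> R) :
  F 0 = 0 -> {homo F : x y / (x < y :> R)} -> F x @[x --> +oo] --> +oo ->
  (forall x : R, is_derive x 1 F (f x)) -> continuous f -> (forall x, 0 <= f x) ->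
  {in `]0, +oo[, continuous G} -> (forall x : R, 0 < x -> 0 <= G x) ->
  (\int[mu]_(x in `]0%R, +oo[) (G x)%:E
   = \int[mu]_(x in `]0%R, +oo[) (G (F x) * f x)%:E)%E.
Proof.
move=> F0 Fincr Fy dF cf f0 cG G0.
have F'E : (F^`())%classic = f by apply/funext => x; rewrite derive1E derive_val.
have cF : continuous F.
  by move=> x; apply/differentiable_continuous/derivable1_diffP; case: (dF x).
have Fgt0 x : 0 < x -> 0 < F x by move=> x0; rewrite -F0 Fincr.
have Fle : {homo F : x y / (x <= y :> R)}.
  by move=> x y; rewrite le_eqVlt => /predU1P[->//|/Fincr/ltW].
pose u (n : nat) : R := n.+1%:R^-1; pose v (n : nat) : R := n.+1%:R.
have u0 n : 0 < u n by rewrite invr_gt0.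
have v1 n : 1 <= v n by rewrite ler1n.
have uv n : u n <= v n by rewrite (le_trans _ (v1 n))// invf_le1 ?ler1n.
have uD n p : (n <= p)%N -> u p <= u n.
  by move=> np; rewrite lef_pV2 ?posrE// ler_nat.
have vD n p : (n <= p)%N -> v n <= v p by rewrite ler_nat.
have exhaust (F' : R -> R) : {homo F' : x y / (x <= y :> R)} ->
    (forall x, 0 < x -> 0 < F' x) ->
    F' (u n) @[n --> \oo] --> 0 -> F' (v n) @[n --> \oo] --> +oo ->
    \bigcup_n `[F' (u n), F' (v n)]%classic = `]0, +oo[%classic.
  move=> F'le F'gt0 F'u F'v; apply/seteqP; split => [x [n _]|x]/=; rewrite !in_itv/= andbT.
    by move=> /andP[+ _]; apply/lt_le_trans/F'gt0.
  move=> x0.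
  have [N _ Nu] : \forall n \near \oo, F' (u n) < x.
    by apply: (cvgr_lt (0:R)).
  have [M _ Mv] : \forall n \near \oo, x <= F' (v n).
    by move/cvgryPge : F'v; apply.
  exists (maxn N M) => //=; rewrite in_itv/=; apply/andP; split.
    by apply/ltW/Nu; rewrite /= leq_maxl.
  by apply: Mv; rewrite /= leq_maxr.
have cvgu : u n @[n --> \oo] --> (0:R) by apply: cvg_harmonic.
have cvgv : v n @[n --> \oo] --> +oo.
  apply/cvgryPge => A; near=> n.
  rewrite (le_trans (ltW (truncnS_gt _)))// ler_nat.
  by near: n; exact: nbhs_infty_ge.
(* Used twice: with F itself for the left integral, with id for the right. *)
have limit (H : R -> R) (F' : R -> R) : {homo F' : x y / (x <= y :> R)} ->
    (forall x, 0 < x -> 0 < F' x) ->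
    F' (u n) @[n --> \oo] --> 0 -> F' (v n) @[n --> \oo] --> +oo ->
    {in `]0, +oo[, continuous H} -> (forall x, 0 < x -> 0 <= H x) ->
    (\int[mu]_(x in `[F' (u n), F' (v n)]) (H x)%:E @[n --> \oo] -->
     \int[mu]_(x in `]0%R, +oo[) (H x)%:E)%E.
  move=> F'le F'gt0 F'u F'v cH H0; rewrite -(exhaust F')//.
  apply: ge0_nondecreasing_set_cvg_integral => //.
  - move=> n p np; rewrite subsetEset; apply: subset_itv; rewrite bnd_simp.
      exact/F'le/uD.
    exact/F'le/vD.
  - move=> n; refine (@measurable_funS _ _ _ _ (`]0, +oo[%classic : set R) _ _ _ _ _) => //.
      apply: subset_itv; rewrite ?bnd_simp//; exact: F'gt0.
    apply/measurable_EFinP; apply: open_continuous_measurable_fun => //.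
    by move=> x; rewrite inE => xi; apply: cH.
  - move=> n x /=; rewrite in_itv/= => /andP[+ _] => ux; rewrite lee_fin H0//.
    exact: (lt_le_trans (F'gt0 _ (u0 n)) ux).
have := limit G F Fle Fgt0.
have Fu : F (u n) @[n --> \oo] --> (0:R).
  by rewrite -F0; apply: (cvg_comp _ _ cvgu); exact: cF.
have Fv : F (v n) @[n --> \oo] --> +oo by apply: (cvg_comp _ _ cvgv).
move=> /(_ Fu Fv cG G0) c1.
have cGF : {in `]0, +oo[, continuous (fun x => G (F x) * f x)}.
  move=> x; rewrite in_itv/= andbT => x0; apply: cvgM; last exact: cf.
  by apply: continuous_comp; [exact: cF|apply: cG; rewrite in_itv/= andbT Fgt0].
have := limit (fun x => G (F x) * f x) id (fun _ _ => id) (fun _ => id) cvgu cvgv cGF.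
have GF0 x : 0 < x -> 0 <= G (F x) * f x by move=> x0; rewrite mulr_ge0// G0// Fgt0.
move=> /(_ GF0) c2.
apply: cvg_unique c1 _ => //.
apply: cvg_trans c2; apply: near_eq_cvg; near=> n.
rewrite integration_by_substitution_increasing ?F'E//.
- by move=> x y _ _; exact: Fincr.
- by apply/cvg_ex; exists (f (u n)); apply: cvg_at_right_filter; exact: cf.
- by apply/cvg_ex; exists (f (v n)); apply: cvg_at_left_filter; exact: cf.
- split.
  + by move=> x _; case: (dF x).
  + by apply: cvg_at_right_filter; exact: cF.
  + by apply: cvg_at_left_filter; exact: cF.
- apply: continuous_in_subspaceT => x; rewrite inE/= in_itv/= => /andP[Fx _].
  by apply: cG; rewrite in_itv/= andbT (lt_le_trans _ Fx)// Fgt0.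
Unshelve. all: end_near. Qed.

Lemma tonelli0y (R : realType) (f : R -> R -> R) :
  measurable_fun [set: R * R] (fun z => f z.1 z.2) -> (forall x y, 0 <= f x y) ->
  (\int[mu]_(x in `]0%R, +oo[)
     \int[mu]_(y in `]0%R, +oo[) (f x y)%:E
   = \int[mu]_(y in `]0%R, +oo[)
     \int[mu]_(x in `]0%R, +oo[) (f x y)%:E)%E.
Proof.
move=> mf f0; pose D := `]0, +oo[%classic : set R.
pose g (z : R * R) := ((\1_D z.1 * \1_D z.2 * f z.1 z.2)%:E)%E.
have mg : measurable_fun setT g.
  apply/measurable_EFinP; apply: measurable_funM => //; apply: measurable_funM.
    by apply: (measurableT_comp (measurable_indic _)) => //; exact: measurable_itv.
  by apply: (measurableT_comp (measurable_indic _)) => //; exact: measurable_itv.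
have g0 z : (0 <= g z)%E by rewrite lee_fin !mulr_ge0.
have m1 (h : R -> R) : measurable_fun setT h ->
    measurable_fun setT (fun y => ((h y)%:E * (\1_D y)%:E)%E).
  move=> mh; apply: (iffRL (@measurable_EFinP _ _ R setT (fun y => h y * \1_D y))).
  by apply: measurable_funM => //; apply: measurable_indic; exact: measurable_itv.
have mf1 x := m1 _ (measurableT_comp mf (measurable_pair1 x)).
have mf2 y := m1 _ (measurableT_comp mf (measurable_pair2 y)).
transitivity (\int[mu]_x \int[mu]_y g (x, y))%E.
  rewrite integral_mkcond; apply: eq_integral => x _.
  rewrite epatch_indic/= [X in (X * _)%E]integral_mkcond epatch_indic/= muleC.
  rewrite -ge0_integralZl//=; last 2 first.
    exact: mf1.
    by move=> y _; rewrite -EFinM lee_fin mulr_ge0.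
  apply: eq_integral => y _; rewrite -!EFinM /g/=; congr EFin.
  by rewrite -mulrA [f _ _ * _]mulrC.
transitivity (\int[mu]_y \int[mu]_x g (x, y))%E.
  exact: fubini_tonelli.
rewrite [RHS]integral_mkcond; apply: eq_integral => y _.
rewrite epatch_indic/= [X in (X * _)%E]integral_mkcond epatch_indic/= muleC.
rewrite -ge0_integralZl//=; last 2 first.
  exact: mf2.
  by move=> x _; rewrite -EFinM lee_fin mulr_ge0.
apply: eq_integral => x _; rewrite -!EFinM /g/=; congr EFin.
by rewrite -mulrA mulrC -mulrA.
Qed.

Lemma integral0yZl (R : realType) (k : R) (f : R -> R) : 0 <= k ->
  measurable_fun setT f -> (forall x, 0 < x -> 0 <= f x) ->
  (\int[mu]_(x in `]0%R, +oo[) (k * f x)%:E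
   = k%:E * \int[mu]_(x in `]0%R, +oo[) (f x)%:E)%E.
Proof.
move=> k0 mf f0; rewrite -ge0_integralZl//.
- exact/measurable_EFinP/measurable_funTS.
- by move=> x; rewrite /= in_itv/= andbT => x0; rewrite lee_fin f0.
Qed.

Lemma eq_integral0y (R : realType) (f g : R -> R) :
  (forall x, 0 < x -> f x = g x) ->
  (\int[mu]_(x in `]0%R, +oo[) (f x)%:E = \int[mu]_(x in `]0%R, +oo[) (g x)%:E)%E.
Proof.
move=> fg; apply: eq_integral => x; rewrite inE/= in_itv/= andbT => x0.
by rewrite fg.
Qed.

Lemma is_derive_mull (R : realType) (u x : R) : is_derive x 1 (fun t : R => u * t) u.
Proof.
have := @is_deriveZ R _ _ (@id R) u x 1 1 (is_derive_id _ _).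
by rewrite /GRing.scale/= mulr1.
Qed.

Lemma scale0y (R : realType) (u : R) (G : R -> R) : 0 < u ->
  (forall x : R, 0 < x -> {for x, continuous G}) -> (forall x : R, 0 < x -> 0 <= G x) ->
  (\int[mu]_(x in `]0%R, +oo[) (G x)%:E
   = \int[mu]_(x in `]0%R, +oo[) (G (u * x) * u)%:E)%E.
Proof.
move=> u0 cG G0.
apply: (@integration_by_substitution0y _ (fun x => u * x) (fun=> u)) => //.
- by rewrite mulr0.
- by move=> x y xy; rewrite ltr_pM2l.
- exact: gt0_cvgMry.
- by move=> x; exact: is_derive_mull.
- by move=> x; exact: cst_continuous.
- by move=> x; exact: ltW.
- by move=> x; rewrite in_itv/= andbT; exact: cG.
Qed.

(** * The Gamma and Beta integrals *)

Lemma continuous_powR0y (R : realType) (p x : R) : 0 < x ->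
  {for x, continuous (fun t : R => t `^ p)}.
Proof.
move=> x0; apply/differentiable_continuous/derivable1_diffP.
by apply: derivable_powR; rewrite in_itv/= andbT.
Qed.

Lemma gt0_powRD (R : realType) (x r s : R) : 0 < x -> x `^ (r + s) = x `^ r * x `^ s.
Proof. by move=> x0; rewrite powRD// (gt_eqF x0) implybT. Qed.

Lemma powRB1M (R : realType) (u r : R) : 0 < u -> u `^ (r - 1) * u = u `^ r.
Proof.
by move=> u0; rewrite -[X in _ * X](powRr1 (ltW u0)) -gt0_powRD// subrK.
Qed.

(** Euler's integral with its value in the extended reals, so that the Tonelli
    computations can be done before it is known to be finite. *)
Definition egamma {R : realType} (r : R) : \bar R :=
  (\int[mu]_(t in `]0%R, +oo[) (t `^ (r - 1) * expR (- t))%:E)%E.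

Lemma measurable_expRNM (R : realType) (u : R) :
  measurable_fun setT (fun t : R => expR (- (u * t))).
Proof. by apply: measurableT_comp => //; apply: measurableT_comp. Qed.

Lemma measurable_gamma_density (R : realType) (p u : R) :
  measurable_fun setT (fun t : R => t `^ p * expR (- (u * t))).
Proof.
apply: measurable_funM; first exact: measurable_powR.
exact: measurable_expRNM.
Qed.

Lemma measurable_gamma_density1 (R : realType) (p : R) :
  measurable_fun setT (fun t : R => t `^ p * expR (- t)).
Proof.
under eq_fun do rewrite -[X in expR (- X)]mul1r.
exact: measurable_gamma_density.
Qed.

Lemma continuous_gamma_density (R : realType) (p x : R) : 0 < x ->
  {for x, continuous (fun t : R => t `^ p * expR (- t))}.
Proof.
move=> x0; apply: cvgM; first exact: continuous_powR0y.
apply: continuous_comp; last exact: continuous_expR.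
exact: cvgN.
Qed.

Lemma egammaZ (R : realType) (r u : R) : 0 < u ->
  (\int[mu]_(t in `]0%R, +oo[) (t `^ (r - 1) * expR (- (u * t)))%:E
   = (u `^ (- r))%:E * egamma r)%E.
Proof.
move=> u0; rewrite /egamma [X in (_ * X)%E](@scale0y _ u)//; first last.
- by move=> x _; rewrite mulr_ge0 ?powR_ge0 ?expR_ge0.
- by move=> x; exact: continuous_gamma_density.
rewrite [X in (_ * X)%E](@eq_integral0y _ _
  (fun t => u `^ r * (t `^ (r - 1) * expR (- (u * t))))); last first.
  by move=> x x0; rewrite powRM ?ltW// -(powRB1M r u0); ring.
rewrite (@integral0yZl _ _ (fun t => t `^ (r - 1) * expR (- (u * t)))) ?powR_ge0//.
- by rewrite muleA -EFinM powRN mulVf ?mul1e// powR_eq0 gt_eqF.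
- exact: measurable_gamma_density.
- by move=> x _; rewrite mulr_ge0 ?powR_ge0 ?expR_ge0.
Qed.

Lemma is_derive_expRM1 (R : realType) (c x : R) :
  is_derive x 1 (fun t : R => expR (c * t) - 1) (expR (c * x) * c).
Proof.
have d1 := is_derive1_comp (is_derive_expR (c * x)) (is_derive_mull c x).
have := is_deriveB d1 (is_derive_cst (1 : R) x 1).
by rewrite subr0.
Qed.

Lemma egamma_ge0 (R : realType) (r : R) : (0 <= egamma r)%E.
Proof. by apply: integral_ge0 => x _; rewrite lee_fin mulr_ge0 ?powR_ge0 ?expR_ge0. Qed.

(** Substituting y = x v in the double integral of
    x^(r-1) y^(s-1) e^(-x-y) and integrating first in x leaves, for each v, a
    Gamma integral of parameter r + s and rate 1 + v. *)
Lemma gamma_pair_integral (R : realType) (r s : R) :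
  (egamma r * egamma s = egamma (r + s) *
   \int[mu]_(v in `]0%R, +oo[) (v `^ (s - 1) * (1 + v) `^ (- (r + s)))%:E)%E.
Proof.
pose f (x v : R) := x `^ (r + s - 1) * v `^ (s - 1) * expR (- ((1 + v) * x)).
have f0 x v : 0 <= f x v by rewrite !mulr_ge0 ?powR_ge0 ?expR_ge0.
transitivity (\int[mu]_(x in `]0%R, +oo[) \int[mu]_(v in `]0%R, +oo[) (f x v)%:E)%E.
  rewrite {1}/egamma -ge0_integralZr//; last 3 first.
  - apply/measurable_EFinP/measurable_funTS.
    exact: measurable_gamma_density1.
  - by move=> x _; rewrite lee_fin mulr_ge0 ?powR_ge0 ?expR_ge0.
  - exact: egamma_ge0.
  apply: eq_integral => x; rewrite inE/= in_itv/= andbT => x0.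
  rewrite /egamma (@scale0y _ x)//; first last.
  - by move=> y _; rewrite mulr_ge0 ?powR_ge0 ?expR_ge0.
  - by move=> y; exact: continuous_gamma_density.
  rewrite -integral0yZl.
  - apply: eq_integral0y => v v0; rewrite /f powRM ?ltW//.
    have -> : r + s - 1 = (r - 1) + s by ring.
    rewrite (gt0_powRD (r - 1) s x0) -(powRB1M s x0).
    have -> : - ((1 + v) * x) = - x + - (x * v) by ring.
    by rewrite expRD; ring.
  - by rewrite mulr_ge0 ?powR_ge0 ?expR_ge0.
  - apply: measurable_funM => //; apply: measurable_funM => //.
      by apply: (measurableT_comp (measurable_powR _)) => //; exact: measurable_funM.
    by apply: measurableT_comp => //; apply: measurableT_comp.
  - by move=> v v0; rewrite !mulr_ge0 ?powR_ge0 ?expR_ge0// ltW.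
rewrite tonelli0y//; last first.
  apply: measurable_funM; first apply: measurable_funM.
  - by apply: (measurableT_comp (measurable_powR _)).
  - by apply: (measurableT_comp (measurable_powR _)).
  - apply: measurableT_comp => //; apply: measurableT_comp => //.
    by apply: measurable_funM => //; apply: measurable_funD.
rewrite muleC -ge0_integralZr ?egamma_ge0//; last 2 first.
- apply/measurable_EFinP/measurable_funTS.
  apply: measurable_funM; first exact: measurable_powR.
  by apply: (measurableT_comp (measurable_powR _)); apply: measurable_funD.
- by move=> x _; rewrite lee_fin mulr_ge0 ?powR_ge0.
apply: eq_integral => v; rewrite inE/= in_itv/= andbT => v0.
have v1 : 0 < 1 + v by rewrite addr_gt0.
rewrite EFinM -muleA -(egammaZ (r + s) v1).
rewrite -(integral0yZl (powR_ge0 v (s - 1))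
                       (measurable_gamma_density (r + s - 1) (1 + v))).
  by apply: eq_integral0y => x x0; rewrite /f; ring.
by move=> x _; rewrite mulr_ge0 ?powR_ge0 ?expR_ge0.
Qed.

(** This is the change of variables v = e^(c l) - 1, which brings the Beta
    integral to the shape of the beta exponential density. *)
Lemma beta_integral_subst (R : realType) (r s c : R) : 0 < c ->
  (\int[mu]_(v in `]0%R, +oo[) (v `^ (s - 1) * (1 + v) `^ (- (r + s)))%:E
  = \int[mu]_(l in `]0%R, +oo[)
      (c * (expR (- (r * c * l)) * (1 - expR (- (c * l))) `^ (s - 1)))%:E)%E.
Proof.
move=> c0.
have dF (x : R) := is_derive_expRM1 c x.
have cM (x : R) : {for x, continuous (fun t : R => expR (c * t))}.
  by apply: continuous_comp; [exact: mulrl_continuous|exact: continuous_expR].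
rewrite (@integration_by_substitution0y _ (fun t => expR (c * t) - 1)
  (fun t => expR (c * t) * c)).
- apply: eq_integral0y => x x0.
  have cx0 : 0 < c * x by rewrite mulr_gt0.
  have e1 : 0 <= 1 - expR (- (c * x)) by rewrite subr_ge0 expR_le1 oppr_le0 ltW.
  have -> : expR (c * x) - 1 = expR (c * x) * (1 - expR (- (c * x))).
    by rewrite mulrBr mulr1 -expRD subrr expR0.
  have -> : 1 + expR (c * x) * (1 - expR (- (c * x))) = expR (c * x).
    by rewrite mulrBr mulr1 -expRD subrr expR0 addrCA subrr addr0.
  rewrite powRM ?expR_ge0// -!expRM.
  have -> : - (r * c * x) = c * x * (s - 1) + c * x * - (r + s) + c * x by ring.
  by rewrite !expRD; ring.
- by rewrite mulr0 expR0 subrr.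
- by move=> x y xy; rewrite ltrD2r ltr_expR ltr_pM2l.
- apply: (@ger_cvgy _ _ _ _ (fun t => c * t)); last exact: gt0_cvgMry.
  by near=> t; rewrite lerBrDl expR_ge1Dx.
- by move=> x; apply: cvgM; [exact: cM|exact: cvg_cst].
- by move=> x; rewrite mulr_ge0 ?expR_ge0// ltW.
- move=> x; rewrite in_itv/= andbT => x0.
  apply: cvgM; first exact: continuous_powR0y.
  apply: (@continuous_comp _ _ _ (fun v : R => 1 + v) (fun t : R => t `^ (- (r + s)))).
    by apply: cvgD; [exact: cvg_cst|exact: cvg_id].
  by apply: continuous_powR0y; rewrite addr_gt0.
- by move=> x x0; rewrite mulr_ge0 ?powR_ge0.
Unshelve. all: end_near. Qed.

(** Up to the factor 1 / B(a, b) this is, for r = b and s = a, the total mass of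
    the beta exponential density; other values of r give its Laplace transform. *)
Definition ibeta {R : realType} (c r s : R) : \bar R :=
  (\int[mu]_(l in `]0%R, +oo[)
     (c * (expR (- (r * c * l)) * (1 - expR (- (c * l))) `^ (s - 1)))%:E)%E.

Lemma egammaM (R : realType) (c r s : R) : 0 < c ->
  (egamma r * egamma s = egamma (r + s) * ibeta c r s)%E.
Proof. by move=> c0; rewrite gamma_pair_integral (beta_integral_subst _ _ c0). Qed.

Lemma egamma1 (R : realType) : egamma (1 : R) = 1%E.
Proof.
rewrite -(@integral_exponential_pdf R 1 ltr01).
transitivity (\int[mu]_(x in `[0%R, +oo[) (expR (- (x : R)))%:E)%E; last first.
  rewrite integral_mkcond; apply: eq_integral => x _.
  by rewrite /exponential_pdf !patchE; case: ifP => // _; rewrite mul1r mulN1r.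
rewrite -integral_itv_obnd_cbnd; last first.
  by apply/measurable_EFinP; apply: measurableT_comp.
by apply: eq_integral0y => t t0; rewrite subrr powRr0 mul1r.
Qed.

(** Since Gamma(1) = 1, the case s = 1 of the product formula is
    Gamma(r) = Gamma(r + 1) / r. *)
Lemma egammaS (R : realType) (r : R) : 0 < r -> (egamma (r + 1) = r%:E * egamma r)%E.
Proof.
move=> r0; have := egammaM r 1 (@ltr01 R); rewrite egamma1 mule1 => ->.
suff -> : ibeta 1 r 1 = (r^-1)%:E.
  by rewrite muleC -muleA -EFinM mulVf ?mule1// gt_eqF.
rewrite /ibeta (@eq_integral0y _ _ (fun t => t `^ (1 - 1) * expR (- (r * t)))); last first.
  by move=> x x0; rewrite subrr !powRr0 !mulr1 !mul1r.
by rewrite egammaZ// egamma1 mule1 powR_inv1 ?ltW.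
Qed.

Lemma egammaD_nat (R : realType) (r : R) n : 0 < r ->
  (egamma (r + n%:R) = (\prod_(i < n) (r + i%:R))%:E * egamma r)%E.
Proof.
move=> r0; elim: n => [|n ih]; first by rewrite big_ord0 addr0 mul1e.
rewrite big_ord_recr/= -natr1 addrA egammaS ?ih ?ltr_wpDr//.
by rewrite muleA -EFinM mulrC.
Qed.

(** For parameters at least 1 the integrand is at least e^(-2) on ]1, 2]; the
    functional equation carries positivity down to all r > 0. *)
Lemma egamma_gt0 (R : realType) (r : R) : 0 < r -> (0 < egamma r)%E.
Proof.
have small (s : R) : 1 <= s -> (0 < egamma s)%E.
  move=> s1; apply: (@lt_le_trans _ _ (\int[mu]_(t in `]1%R, 2%R]) (expR (- 2))%:E)%E).
    rewrite integral_cst//= lebesgue_measure_itv/= lte_fin ltr1n.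
    by rewrite -EFinB -EFinM lte_fin mulr_gt0 ?expR_gt0//; lra.
  apply: (@le_trans _ _ (\int[mu]_(t in `]1%R, 2%R]) (t `^ (s - 1) * expR (- t))%:E)%E).
    apply: ge0_le_integral => //.
    - apply/measurable_EFinP/measurable_funTS.
      exact: measurable_gamma_density1.
    - move=> x /=; rewrite in_itv/= => /andP[x1 x2]; rewrite lee_fin.
      rewrite -[leLHS]mul1r ler_pM ?expR_ge0// ?ler_expR ?lerN2//.
      by rewrite -[leLHS](powRr0 x) ler_powR ?subr_ge0// ltW.
  apply: ge0_subset_integral => //.
  - apply/measurable_EFinP/measurable_funTS.
    exact: measurable_gamma_density1.
  - by move=> x _; rewrite lee_fin mulr_ge0 ?powR_ge0 ?expR_ge0.
  - by apply: subset_itv; rewrite ?bnd_simp.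
move=> r0; have := small (r + 1); rewrite lerDr (ltW r0) egammaS// => /(_ isT).
by rewrite pmule_rgt0// lte_fin.
Qed.

(** For s >= 1 the power t^(s-1) lies below 1 + t^n for n large, and the integral of
    (1 + t^n) e^(-t) is 1 + n! by the functional equation. The case r < 1 follows
    from the value at r + 1, again by the functional equation. *)
Lemma egamma_fin_num (R : realType) (r : R) : 0 < r -> egamma r \is a fin_num.
Proof.
have large (s : R) : 1 <= s -> egamma s \is a fin_num.
  move=> s1; pose n := Num.truncn s.
  have nE : egamma (1 + n.+1%:R : R) \is a fin_num.
    by rewrite egammaD_nat// egamma1 mule1.
  rewrite ge0_fin_numE ?egamma_ge0//.
  apply: (@le_lt_trans _ _ (egamma 1 + egamma (1 + n.+1%:R))%E); last first.
    by rewrite egamma1 lte_add_pinfty ?ltry// -ge0_fin_numE ?egamma_ge0.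
  have m1 (p : R) : measurable_fun (`]0, +oo[%classic : set R)
      (fun t : R => (t `^ p * expR (- t))%:E).
    apply/measurable_EFinP/measurable_funTS.
    exact: measurable_gamma_density1.
  have g0 (p x : R) : (0 <= (x `^ p * expR (- x))%:E)%E.
    by rewrite lee_fin mulr_ge0 ?powR_ge0 ?expR_ge0.
  rewrite /egamma -ge0_integralD//; [|exact: m1|exact: m1].
  apply: ge0_le_integral => //.
  - exact: m1.
  - exact: (emeasurable_funD (m1 _) (m1 _)).
  - move=> x /=; rewrite in_itv/= andbT => x0; rewrite -EFinD lee_fin -mulrDl.
    rewrite ler_wpM2r ?expR_ge0// subrr powRr0 addrAC subrr add0r.
    have [x1|x1] := leP x 1.
      rewrite -[leLHS]addr0 lerD ?powR_ge0//.
      by rewrite -[leRHS](powRr0 x) ger_powR ?x0 ?subr_ge0.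
    rewrite -[leLHS]add0r lerD// ler_powR ?ltW//.
    by rewrite ltrBlDr (lt_trans (truncnS_gt s))// ltrDl.
move=> r0; have := large (r + 1); rewrite lerDr (ltW r0) egammaS// => /(_ isT).
have := egamma_ge0 r; case: (egamma r) => [x| |]// _.
by rewrite gt0_muley// lte_fin.
Qed.

Lemma GammaE (R : realType) (r : R) : 0 < r -> (Gamma r)%:E = egamma r.
Proof. by move=> r0; rewrite /Gamma /Rintegral fineK// egamma_fin_num. Qed.

Lemma Gamma_gt0 (R : realType) (r : R) : 0 < r -> 0 < Gamma r.
Proof. by move=> r0; rewrite -lte_fin GammaE// egamma_gt0. Qed.

Lemma GammaD_nat (R : realType) (r : R) n : 0 < r ->
  Gamma (r + n%:R) = \prod_(i < n) (r + i%:R) * Gamma r.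
Proof.
move=> r0; apply: EFin_inj.
by rewrite EFinM !GammaE ?ltr_wpDr// egammaD_nat.
Qed.

Lemma Beta_gt0 (R : realType) (r s : R) : 0 < r -> 0 < s -> 0 < Beta r s.
Proof. by move=> r0 s0; rewrite divr_gt0 ?mulr_gt0 ?Gamma_gt0 ?addr_gt0. Qed.

Lemma BetaC (R : realType) (r s : R) : Beta r s = Beta s r.
Proof. by rewrite /Beta addrC [Gamma r * _]mulrC. Qed.

Lemma ibetaE (R : realType) (c r s : R) : 0 < c -> 0 < r -> 0 < s ->
  ibeta c r s = (Beta r s)%:E.
Proof.
move=> c0 r0 s0; have rs := addr_gt0 r0 s0.
rewrite /Beta mulrC EFinM EFinM !GammaE// (egammaM r s c0) -(GammaE rs) muleA -EFinM.
by rewrite mulVf ?mul1e// gt_eqF// Gamma_gt0.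
Qed.

(** * The negative binomial distribution *)

Definition rising {R : realType} (m : R) (n : nat) : R := \prod_(i < n) (m + i%:R).

Lemma rising_ge0 (R : realType) (m : R) n : 0 <= m -> 0 <= rising m n.
Proof. by move=> m0; apply: prodr_ge0 => i _; rewrite addr_ge0. Qed.

Lemma risingD (R : realType) (m : R) n k :
  rising m (n + k) = rising m n * rising (m + n%:R) k.
Proof.
rewrite /rising big_split_ord/=; congr (_ * _).
by apply: eq_bigr => i _; rewrite natrD addrA.
Qed.

Lemma falling_rising (R : realType) (m : R) n : falling (m + n%:R - 1) n = rising m n.
Proof.
rewrite /falling /rising (reindex_inj rev_ord_inj)/=; apply: eq_bigr => i _.
by rewrite natrB ?ltn_ord// -natr1; ring.
Qed.

Lemma falling_natr (R : realType) n k : falling n%:R k = (n ^_ k)%:R :> R.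
Proof.
elim: k => [|k ih]; first by rewrite /falling big_ord0 ffactn0.
rewrite /falling big_ord_recr/= -/(falling _ _) ih ffactnSr natrM.
have [kn|nk] := leqP k n; first by rewrite natrB.
by rewrite ffact_small// !mul0r.
Qed.

Lemma gnb_pmf_beta1 (R : realType) (m theta : R) x : 0 < m ->
  gnb_pmf m 1 theta x = rising m x / x`!%:R * (1 - theta) ^+ x * theta `^ m.
Proof.
move=> m0; rewrite /gnb_pmf mul1r addrK; congr (_ * _ * _).
rewrite /rbinom mulrA; congr (_ / _).
have -> : m + x%:R = m + 1 + x%:R - 1 by ring.
rewrite falling_rising.
have e : rising m x.+1 = m * rising (m + 1) x by rewrite -add1n risingD /rising big_ord1 addr0.
have {e}: rising m x * (m + x%:R) = m * rising (m + 1) x by rewrite -e /rising big_ord_recr.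
have -> : m + 1 + x%:R - 1 = m + x%:R by ring.
have mx : m + x%:R != 0 by rewrite gt_eqF// ltr_wpDr.
by move=> e; rewrite mulrAC -e mulfK.
Qed.

Lemma nneseries_expR (R : realType) (x : R) :
  (\sum_(0 <= n <oo) (x ^+ n / n`!%:R)%:E = (expR x)%:E)%E.
Proof.
rewrite /expR -EFin_lim; last exact: is_cvg_series_exp_coeff.
apply: congr_lim; apply/funext => n /=.
by rewrite sumEFin.
Qed.

(** Multiplied by Gamma(m), the coefficient rising m x becomes Gamma(m + x), so
    that the series is the integral of t^(m-1) e^(-t) times the exponential series
    of q t; what remains is the Gamma integral of rate 1 - q. *)
Lemma negative_binomial_series (R : realType) (m q : R) : 0 < m -> 0 <= q < 1 ->
  (\sum_(0 <= x <oo) (rising m x / x`!%:R * q ^+ x)%:E = ((1 - q) `^ (- m))%:E)%E.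
Proof.
move=> m0 /andP[q0 q1].
have G0 := Gamma_gt0 m0.
have coef0 x : 0 <= rising m x / x`!%:R * q ^+ x.
  by rewrite mulr_ge0 ?exprn_ge0// divr_ge0// rising_ge0// ltW.
suff : ((Gamma m)%:E * \sum_(0 <= x <oo) (rising m x / x`!%:R * q ^+ x)%:E
        = (Gamma m)%:E * ((1 - q) `^ (- m))%:E)%E.
  move=> /(congr1 (fun z => (Gamma m)^-1%:E * z)%E).
  by rewrite !muleA -!EFinM mulVf ?gt_eqF// mul1e mul1r => ->.
rewrite -nneseriesZl; last by move=> x _; rewrite lee_fin.
rewrite [RHS]muleC [in RHS]GammaE// -egammaZ ?subr_gt0//.
pose g n (t : R) := ((q * t) ^+ n / n`!%:R) * (t `^ (m - 1) * expR (- t)).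
have mg n : measurable_fun setT (g n).
  apply: measurable_funM.
    by apply: measurable_funM => //; apply: measurable_funX; exact: measurable_funM.
  exact: measurable_gamma_density1.
have g0 n t : 0 < t -> 0 <= g n t.
  move=> t0; rewrite !mulr_ge0 ?exprn_ge0 ?mulr_ge0 ?invr_ge0 ?powR_ge0 ?expR_ge0//.
  exact: ltW.
transitivity (\sum_(0 <= n <oo) \int[mu]_(t in `]0%R, +oo[) (g n t)%:E)%E.
  apply: eq_eseriesr => n _.
  rewrite (@eq_integral0y _ _
    (fun t => q ^+ n / n`!%:R * (t `^ (m + n%:R - 1) * expR (- t)))); last first.
    move=> t t0; rewrite /g exprMn -addrA [n%:R - 1]addrC addrA.
    by rewrite (gt0_powRD (m - 1) n%:R t0) powR_mulrn ?ltW//; ring.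
  rewrite integral0yZl.
  - rewrite -/(egamma (m + n%:R)) egammaD_nat// -/(rising m n) -GammaE// -!EFinM.
    by congr EFin; ring.
  - by rewrite mulr_ge0 ?exprn_ge0 ?invr_ge0.
  - exact: measurable_gamma_density1.
  - by move=> t t0; rewrite mulr_ge0 ?powR_ge0 ?expR_ge0.
rewrite -integral_nneseries//; last 2 first.
- by move=> n; apply/measurable_EFinP/measurable_funTS; exact: mg.
- by move=> n t; rewrite /= in_itv/= andbT => t0; rewrite lee_fin g0.
apply: eq_integral => t; rewrite inE/= in_itv/= andbT => t0.
under eq_eseriesr do rewrite /g mulrC EFinM.
rewrite nneseriesZl; last by move=> n _; rewrite lee_fin divr_ge0// exprn_ge0// mulr_ge0// ltW.
rewrite nneseries_expR -EFinM -mulrA -expRD; congr (_ * expR _)%:E.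
by ring.
Qed.

(** The terms x < k vanish; shifting x by k, the falling factorial cancels against
    x! and what is left is the negative binomial series of parameter m + k. *)
Lemma nb_factorial_moment (R : realType) (m theta : R) k : 0 < m -> 0 < theta <= 1 ->
  (\sum_(0 <= x <oo) (falling x%:R k * gnb_pmf m 1 theta x)%:E
   = (rising m k * ((1 - theta) ^+ k * theta `^ (- k%:R)))%:E)%E.
Proof.
move=> m0 /andP[t0 t1].
(* The factor that the shift by k leaves in front of the series. *)
pose C := rising m k * (1 - theta) ^+ k * theta `^ m.
have C0 : 0 <= C by rewrite !mulr_ge0 ?powR_ge0 ?rising_ge0 ?exprn_ge0 ?subr_ge0// ltW.
have mk0 : 0 < m + k%:R by rewrite ltr_wpDr.
have f0 x : (0 <= (falling x%:R k * gnb_pmf m 1 theta x)%:E)%E.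
  rewrite lee_fin falling_natr gnb_pmf_beta1// !mulr_ge0 ?powR_ge0 ?rising_ge0//.
  - exact: ltW.
  - by rewrite exprn_ge0// subr_ge0.
rewrite (nneseries_split 0 k)// add0n big1_seq ?add0e; last first.
  move=> x /=; rewrite mem_index_iota => /andP[_ xk].
  by rewrite falling_natr ffact_small// mul0r.
rewrite -nneseries_addn//.
transitivity (\sum_(0 <= x <oo) (C%:E *
    (rising (m + k%:R) x / x`!%:R * (1 - theta) ^+ x)%:E))%E.
  apply: eq_eseriesr => x _; rewrite -EFinM; congr EFin.
  rewrite gnb_pmf_beta1// falling_natr addnC risingD /C.
  have -> : ((k + x)`!%:R : R) = ((k + x) ^_ k)%:R * x`!%:R.
    by rewrite -natrM -(ffact_fact (leq_addr x k)) addKn.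
  have ne : ((k + x) ^_ k)%:R != 0 :> R by rewrite pnatr_eq0 -lt0n ffact_gt0 leq_addr.
  have nx : x`!%:R != 0 :> R by rewrite pnatr_eq0 -lt0n fact_gt0.
  by rewrite exprD; field; rewrite ne nx.
rewrite nneseriesZl; last first.
  move=> x _; rewrite lee_fin !mulr_ge0 ?rising_ge0 ?exprn_ge0 ?subr_ge0//.
  exact: ltW.
rewrite negative_binomial_series//; last by rewrite subr_ge0 t1 ltrBlDr ltrDl.
rewrite -EFinM subKr /C; congr EFin.
by rewrite -!mulrA -gt0_powRD// opprD addrA subrr add0r.
Qed.

(** * Mixing over the beta exponential distribution *)

Section beta_exponential.
Context {R : realType} {a b c : R} (a0 : 0 < a) (b0 : 0 < b) (c0 : 0 < c).

Lemma measurable_be_pdf : measurable_fun setT (be_pdf a b c).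
Proof.
apply: measurable_funM; first apply: measurable_funM => //.
  exact: measurable_expRNM.
apply: (measurableT_comp (measurable_powR _)); apply: measurable_funB => //.
exact: measurable_expRNM.
Qed.

Lemma be_pdf_ge0 l : 0 <= be_pdf a b c l.
Proof.
by rewrite /be_pdf !mulr_ge0 ?expR_ge0 ?powR_ge0 ?invr_ge0// ltW// Beta_gt0.
Qed.

Lemma be_laplace p : 0 < b + p / c ->
  (\int[mu]_(l in `]0%R, +oo[) (expR (- (p * l)) * be_pdf a b c l)%:E
   = (Beta (b + p / c) a / Beta a b)%:E)%E.
Proof.
move=> bp0; rewrite (@eq_integral0y _ _ (fun l => (Beta a b)^-1 *
  (c * (expR (- ((b + p / c) * c * l)) * (1 - expR (- (c * l))) `^ (a - 1))))); last first.
  move=> l l0; rewrite /be_pdf.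
  have -> : - ((b + p / c) * c * l) = - (p * l) + - (b * c * l).
    by field; rewrite gt_eqF.
  by rewrite expRD; ring.
rewrite integral0yZl -/(ibeta c (b + p / c) a).
- by rewrite ibetaE// -EFinM mulrC.
- by rewrite invr_ge0 ltW// Beta_gt0.
- apply: measurable_funM => //; apply: measurable_funM.
    exact: measurable_expRNM.
  apply: (measurableT_comp (measurable_powR _)); apply: measurable_funB => //.
  exact: measurable_expRNM.
- by move=> x x0; rewrite !mulr_ge0 ?expR_ge0 ?powR_ge0// ltW.
Qed.

Lemma be_laplace_integrable p : 0 < b + p / c ->
  mu.-integrable `]0, +oo[ (fun l => (expR (- (p * l)) * be_pdf a b c l)%:E).
Proof.
move=> bp0; apply/integrableP; split.
  apply/measurable_EFinP/measurable_funTS; apply: measurable_funM.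
    exact: measurable_expRNM.
  exact: measurable_be_pdf.
rewrite (_ : integral _ _ _ = (Beta (b + p / c) a / Beta a b)%:E) ?ltry//.
rewrite -be_laplace//; apply: eq_integral => l _.
by rewrite gee0_abs// lee_fin mulr_ge0 ?expR_ge0 ?be_pdf_ge0.
Qed.

(** Both closed forms of the theorem are instances of this one: p = m gives the
    mass function, p = - k the factorial moment. *)
Lemma be_binomial_moment p n : 0 < b + p / c ->
  (\int[mu]_(l in `]0%R, +oo[)
     ((1 - expR (- l)) ^+ n * expR (- (p * l)) * be_pdf a b c l)%:E
   = (\sum_(0 <= j < n.+1) 'C(n, j)%:R * (-1) ^+ j *
       (Beta (b + (p + j%:R) / c) a / Beta a b))%:E)%E.
Proof.
move=> bp0.
have bpj j : 0 < b + (p + j%:R) / c.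
  by rewrite mulrDl addrA ltr_wpDr// divr_ge0// ltW.
transitivity (\int[mu]_(l in `]0%R, +oo[) \sum_(0 <= j < n.+1)
    (('C(n, j)%:R * (-1) ^+ j)%:E * (expR (- ((p + j%:R) * l)) * be_pdf a b c l)%:E))%E.
  apply: eq_integral => l _.
  under [RHS]eq_bigr do rewrite -EFinM.
  rewrite sumEFin; congr EFin.
  rewrite exprBn big_mkord !mulr_suml; apply: eq_bigr => j _.
  rewrite expr1n mulr1 -mulr_natl -expRM_natl mulrDl opprD expRD mulrN; ring.
rewrite integral_sum//; last first.
  by move=> j; apply: integrableZl => //; exact: be_laplace_integrable.
rewrite -sumEFin; apply: eq_bigr => j _.
by rewrite integralZl//; [rewrite be_laplace|exact: be_laplace_integrable].
Qed.

End beta_exponential.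

Section mixture.
Context {R : realType} {m a b c : R}.
Context (m0 : 0 < m) (a0 : 0 < a) (b0 : 0 < b) (c0 : 0 < c).

Lemma gnbbe_pmf_beta1 x : gnbbe_pmf m 1 a b c x = (nbbe_pmf m a b c x)%:E.
Proof.
rewrite /nbbe_pmf EFinM -be_binomial_moment//; last by rewrite ltr_wpDr// divr_ge0// ltW.
rewrite /gnbbe_pmf -integral0yZl.
- apply: eq_integral0y => l l0; rewrite gnb_pmf_beta1// /rbinom falling_rising.
  by rewrite -expRM mulNr [l * m]mulrC; ring.
- by rewrite /rbinom falling_rising divr_ge0// rising_ge0// ltW.
- apply: measurable_funM; last exact: measurable_be_pdf.
  apply: measurable_funM; last first.
    exact: measurable_expRNM.
  apply: measurable_funX; apply: measurable_funB => //.
  by apply: measurableT_comp => //; apply: measurableT_comp.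
- move=> l l0; rewrite mulr_ge0 ?be_pdf_ge0// mulr_ge0 ?expR_ge0// exprn_ge0//.
  by rewrite subr_ge0 expR_le1 oppr_le0 ltW.
Qed.

Lemma gnb_pmf_ge0 theta x : 0 <= theta <= 1 -> 0 <= gnb_pmf m 1 theta x.
Proof.
move=> /andP[t0 t1]; rewrite gnb_pmf_beta1// !mulr_ge0 ?powR_ge0//.
- by rewrite rising_ge0// ltW.
- by rewrite exprn_ge0// subr_ge0.
Qed.

Lemma measurable_gnb_pmf x : measurable_fun setT (fun l : R => gnb_pmf m 1 (expR (- l)) x).
Proof.
under eq_fun do rewrite gnb_pmf_beta1//.
apply: measurable_funM.
  apply: measurable_funM => //; apply: measurable_funX; apply: measurable_funB => //.
  by apply: measurableT_comp => //; apply: measurableT_comp.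
apply: (measurableT_comp (measurable_powR _)).
by apply: measurableT_comp => //; apply: measurableT_comp.
Qed.

(** Exchanging sum and integral reduces the k-th factorial moment of the mixture to
    the beta exponential mean of the conditional moment, which is rising m k times
    (1 - e^(-l))^k e^(k l). The condition k / c < b makes that mean finite.
    Expectations are avoided here, since the case k = 0 is what shows that the
    mixture is a probability. *)
Lemma gnbbe_falling_sum k : k%:R / c < b ->
  (\sum_(0 <= x <oo) (falling x%:R k)%:E * gnbbe_pmf m 1 a b c x
   = (rising m k * \sum_(0 <= j < k.+1)
         'C(k, j)%:R * (-1) ^+ j * (Beta (b - (k - j)%:R / c) a / Beta a b))%:E)%E.
Proof.
move=> kb.
have t01 (l : R) : 0 < l -> 0 < expR (- l) <= 1.
  by move=> l0; rewrite expR_gt0 expR_le1 oppr_le0 ltW.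
pose g x l := falling x%:R k * gnb_pmf m 1 (expR (- l)) x * be_pdf a b c l.
have g0 x l : 0 < l -> 0 <= g x l.
  move=> l0; rewrite mulr_ge0 ?be_pdf_ge0// falling_natr mulr_ge0// gnb_pmf_ge0//.
  by have /andP[/ltW -> ->] := t01 l l0.
transitivity (\sum_(0 <= x <oo) \int[mu]_(l in `]0%R, +oo[) (g x l)%:E)%E.
  apply: eq_eseriesr => x _; rewrite /gnbbe_pmf -integral0yZl.
  - by apply: eq_integral0y => l l0; rewrite mulrA.
  - by rewrite falling_natr.
  - apply: measurable_funM; [exact: measurable_gnb_pmf|exact: measurable_be_pdf].
  - move=> l l0; rewrite mulr_ge0 ?be_pdf_ge0// gnb_pmf_ge0//.
    by have /andP[/ltW -> ->] := t01 l l0.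
rewrite -integral_nneseries//; last 2 first.
- move=> x; apply/measurable_EFinP/measurable_funTS.
  apply: measurable_funM; last exact: measurable_be_pdf.
  by apply: measurable_funM => //; exact: measurable_gnb_pmf.
- by move=> x l; rewrite /= in_itv/= andbT => l0; rewrite lee_fin g0.
transitivity (\int[mu]_(l in `]0%R, +oo[) (rising m k *
    ((1 - expR (- l)) ^+ k * expR (- (- k%:R * l)) * be_pdf a b c l))%:E)%E.
  apply: eq_integral => l; rewrite inE/= in_itv/= andbT => l0.
  have gE x : (g x l)%:E = ((be_pdf a b c l)%:E *
      (falling x%:R k * gnb_pmf m 1 (expR (- l)) x)%:E)%E.
    by congr EFin; rewrite /g [RHS]mulrC.
  under eq_eseriesr do rewrite gE.
  rewrite nneseriesZl; last first.
    move=> x _; rewrite lee_fin falling_natr mulr_ge0// gnb_pmf_ge0//.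
    by have /andP[/ltW -> ->] := t01 l l0.
  rewrite nb_factorial_moment ?t01// -EFinM -expRM; congr EFin.
  have -> : - l * - k%:R = - (- k%:R * l) by ring.
  by ring.
rewrite integral0yZl.
- have bk : 0 < b + - k%:R / c by rewrite mulNr subr_gt0.
  have sumE : \sum_(0 <= j < k.+1) 'C(k, j)%:R * (-1) ^+ j *
        (Beta (b + (- k%:R + j%:R) / c) a / Beta a b) =
      \sum_(0 <= j < k.+1) 'C(k, j)%:R * (-1) ^+ j *
        (Beta (b - (k - j)%:R / c) a / Beta a b).
    apply: eq_big_nat => j /andP[_ jk]; rewrite natrB; last by rewrite -ltnS.
    by have -> : (- k%:R + j%:R) / c = - ((k%:R - j%:R) / c) by ring.
  by rewrite (be_binomial_moment a0 b0 c0 _ bk) sumE EFinM.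
- by rewrite rising_ge0// ltW.
- apply: measurable_funM; last exact: measurable_be_pdf.
  apply: measurable_funM; last first.
    exact: measurable_expRNM.
  apply: measurable_funX; apply: measurable_funB => //.
  by apply: measurableT_comp => //; apply: measurableT_comp.
- move=> l l0; rewrite mulr_ge0 ?be_pdf_ge0// mulr_ge0 ?expR_ge0// exprn_ge0//.
  by rewrite subr_ge0 expR_le1 oppr_le0 ltW.
Qed.

Lemma is_pmf_gnbbe : is_pmf (gnbbe_pmf m 1 a b c).
Proof.
split.
  move=> x; apply: integral_ge0 => l; rewrite /= in_itv/= andbT => l0.
  rewrite lee_fin mulr_ge0 ?be_pdf_ge0// gnb_pmf_ge0// expR_ge0 expR_le1 oppr_le0.
  exact: ltW.
have := @gnbbe_falling_sum 0; rewrite mul0r => /(_ b0).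
rewrite big_nat1 /rising big_ord0 bin0 expr0 !mul1r subr0 BetaC divff ?gt_eqF ?Beta_gt0//.
move=> <-; apply: eq_eseriesr => x _.
by rewrite /falling big_ord0 mul1e.
Qed.

End mixture.

(** * Factorial moments *)

Lemma expectation_discrete_prob (R : realType) (p : nat -> \bar R) (f : nat -> R) :
  is_pmf p -> (forall x, 0 <= f x) ->
  ('E_(discrete_prob p)[f] = \sum_(0 <= x <oo) (f x)%:E * p x)%E.
Proof.
move=> pP f0; rewrite expectation.unlock.
have -> : [set: nat] = \bigcup_k [set k] by rewrite bigcup_imset1 image_id.
rewrite ge0_integral_bigcup//; last 2 first.
- by move=> x _; rewrite lee_fin.
- by move=> i j _ _ [x [-> ->]].
apply: eq_eseriesr => x _.
rewrite (@eq_integral _ _ _ _ _ (cst (f x)%:E)); last by move=> y; rewrite inE/= => ->.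
have pE : discrete_prob p [set x] = (\esum_(i in [set x]) p i)%E.
  by rewrite /discrete_prob asboolT.
by rewrite integral_cst//=; congr (_ * _)%E; rewrite pE esum_set1//; case: pP.
Qed.

Unset Implicit Arguments.

Theorem corollary1 (R : realType) (m beta a b c : R) (k : nat)
  (hm : 0 < m) (ha : 0 < a) (hb : 0 < b) (hc : 0 < c)
  (hk : (1 <= k)%N) (hbk : k%:R / c < b) (hbeta : beta = 1) :
  factorial_moment (gnbbe_prob m beta a b c) k
    = factorial_moment (nbbe_prob m a b c) k
  /\ factorial_moment (nbbe_prob m a b c) k
    = (Gamma (m + k%:R) / Gamma m *
       \sum_(0 <= j < k.+1)
         'C(k, j)%:R * (-1) ^+ j * (Beta (b - (k - j)%:R / c) a / Beta a b))%:E.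
Proof.
have pE : (fun x => (nbbe_pmf m a b c x)%:E) = gnbbe_pmf m 1 a b c.
  by apply/funext => x; rewrite gnbbe_pmf_beta1.
rewrite hbeta /gnbbe_prob /nbbe_prob pE; split=> //.
rewrite /factorial_moment expectation_discrete_prob; last 2 first.
- exact: is_pmf_gnbbe.
- by move=> x; rewrite falling_natr.
rewrite gnbbe_falling_sum// GammaD_nat// -/(rising m k) mulfK//.
by rewrite gt_eqF// Gamma_gt0.
Qed.
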